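(* Let $p$ be an odd prime, $0\le m\le p-2$, $a\in\mathbb Z_p^\times$, $c\in p\mathbb Z_p$. Then $K_{a,c,m}(z,w)\in \mathbb Z_p\langle z\rangle\hat\otimes S_w$; that is, writing $K_{a,c,m}=\sum_{i,j}\alpha_{ij}z^iw^j$, all $\alpha_{ij}\in\mathbb Z_p$ and $\mathrm{ord}_p(\alpha_{ij})\ge j\,c_p$.
   Context: $c_p=1-\frac1{p-1}$. For a variable $x$, $S_x=\{\sum_n a_nx^n\in\mathbb Q_p\langle x\rangle:\ \mathrm{ord}_p(a_n)\ge nc_p\}$. Fix a topological generator $\gamma$ of $1+p\mathbb Z_p$, let $\omega$ be the Teichmüller character, $\log_\gamma=\log/\log\gamma$, and $K_{a,c,m}(z,w)=\omega(a)^m\sum_{n\ge0}\binom{\log_\gamma((a+cz)/\omega(a))}{n}(pw)^n$. *)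

(* Defs.v *)
From HB Require Import structures.
From mathcomp Require Import all_boot all_order all_algebra.
From mathcomp Require Import boolp classical_sets constructive_ereal.

Set Implicit Arguments.
Unset Strict Implicit.
Unset Printing Implicit Defensive.

Import Order.TTheory GRing.Theory Num.Theory.
Local Open Scope ring_scope.

(* Z_p is the inverse limit of the rings Z/p^n: [pres x n] is the canonical
   representative, in the range 0 <= r < p^n, of the class of x modulo p^n. *)
Record padic_int (p : nat) (p_pr : prime p) := PadicInt {
  pres :> nat -> int;
  _ : forall n, pres n = (pres n.+1 %% (p ^ n)%N%:Z)%Z }.

Section PadicIntRing.
Variables (p : nat) (p_pr : prime p).
Local Notation Z_p := (padic_int p_pr).
Local Notation q n := (p ^ n)%N%:Z.

Lemma pres_eq (x y : Z_p) : (forall n, x n = y n) -> x = y.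
Proof.
case: x y => [f fP] [g gP] /= /funext fg; rewrite -{}fg in gP *.
by rewrite (Prop_irrelevance fP gP).
Qed.

Lemma presS (x : Z_p) n : x n = (x n.+1 %% q n)%Z.
Proof. by case: x. Qed.

Lemma q_neq0 n : q n != 0.
Proof. by rewrite -lt0n expn_gt0 prime_gt0. Qed.

Lemma modz_qS (a : int) n : ((a %% q n.+1)%Z %% q n)%Z = (a %% q n)%Z.
Proof.
rewrite [in RHS](divz_eq a (q n.+1)) expnSr PoszM [q n * _]mulrC mulrA.
by rewrite modzMDl mulrC.
Qed.

Lemma pres_mod (x : Z_p) n : (x n %% q n)%Z = x n.
Proof. by rewrite (presS x) modz_mod. Qed.

Definition of_compat (f : nat -> int)
    (fP : forall n, (f n.+1 %% q n)%Z = (f n %% q n)%Z) : Z_p.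
Proof. by exists (fun n => (f n %% q n)%Z) => n; rewrite modz_qS fP. Defined.

Fact padd_key (x y : Z_p) n :
  ((x n.+1 + y n.+1) %% q n)%Z = ((x n + y n) %% q n)%Z.
Proof. by rewrite -modzDm -!presS. Qed.
Fact popp_key (x : Z_p) n : ((- x n.+1) %% q n)%Z = ((- x n) %% q n)%Z.
Proof. by rewrite -modzNm -presS. Qed.
Fact pmul_key (x y : Z_p) n :
  ((x n.+1 * y n.+1) %% q n)%Z = ((x n * y n) %% q n)%Z.
Proof. by rewrite -modzMm -!presS. Qed.

Definition pcst (a : int) : Z_p := @of_compat (fun=> a) (fun=> erefl).
Definition padd (x y : Z_p) : Z_p := of_compat (padd_key x y).
Definition popp (x : Z_p) : Z_p := of_compat (popp_key x).
Definition pmul (x y : Z_p) : Z_p := of_compat (pmul_key x y).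

Lemma paddA : associative padd.
Proof. by move=> x y z; apply: pres_eq => n /=; rewrite modzDmr modzDml addrA. Qed.
Lemma paddC : commutative padd.
Proof. by move=> x y; apply: pres_eq => n /=; rewrite addrC. Qed.
Lemma padd0 : left_id (pcst 0) padd.
Proof. by move=> x; apply: pres_eq => n /=; rewrite modzDml add0r pres_mod. Qed.
Lemma paddN : left_inverse (pcst 0) popp padd.
Proof. by move=> x; apply: pres_eq => n /=; rewrite modzDml addNr. Qed.
Lemma pmulA : associative pmul.
Proof. by move=> x y z; apply: pres_eq => n /=; rewrite modzMmr modzMml mulrA. Qed.
Lemma pmulC : commutative pmul.
Proof. by move=> x y; apply: pres_eq => n /=; rewrite mulrC. Qed.
Lemma pmul1 : left_id (pcst 1) pmul.
Proof. by move=> x; apply: pres_eq => n /=; rewrite modzMml mul1r pres_mod. Qed.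
Lemma pmulD : left_distributive pmul padd.
Proof. by move=> x y z; apply: pres_eq => n /=; rewrite modzMml modzDm mulrDl. Qed.
Lemma pone_neq0 : pcst 1 <> pcst 0.
Proof.
move=> /(congr1 (fun x : Z_p => x 1)) /=; rewrite expn1 mod0z modz_small //.
by rewrite /= ltz_nat prime_gt1.
Qed.

HB.instance Definition _ := gen_eqMixin Z_p.
HB.instance Definition _ := gen_choiceMixin Z_p.
HB.instance Definition _ := GRing.isZmodule.Build Z_p paddA paddC padd0 paddN.
Fact pone_neq0b : pcst 1 != 0.
Proof. exact/eqP/pone_neq0. Qed.
HB.instance Definition _ := GRing.Zmodule_isComNzRing.Build Z_p
  pmulA pmulC pmul1 pmulD pone_neq0b.

(* Units are the elements having a multiplicative inverse. *)
Definition pinvertible (x : Z_p) : bool := `[< exists y, y * x = 1 >].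
Definition pinv (x : Z_p) : Z_p :=
  if pinvertible x then xget x [set y | y * x = 1] else x.

Fact pmulV : {in pinvertible, left_inverse 1 pinv *%R}.
Proof.
move=> x; rewrite /in_mem /= /pinv => xU; rewrite xU; move/asboolP: xU => [y yx].
by case: xgetP => [_ -> //|/(_ y)].
Qed.
Fact pinvertible_intro x y : y * x = 1 -> pinvertible x.
Proof. by move=> yx; apply/asboolP; exists y. Qed.
Fact pinv_out : {in [predC pinvertible], pinv =1 id}.
Proof. by move=> x; rewrite /in_mem /= /pinv => /negbTE ->. Qed.

HB.instance Definition _ := GRing.ComNzRing_hasMulInverse.Build Z_p
  pmulV pinvertible_intro pinv_out.

Lemma pres0 n : (0 : Z_p) n = 0.
Proof. by rewrite /= mod0z. Qed.

Lemma pres_dvd (x : Z_p) n k : ((q n %| x (n + k)%N) = (x n == 0))%Z.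
Proof.
have -> : x n = (x (n + k)%N %% q n)%Z; last by apply/idP/eqP => /dvdz_mod0P.
elim: k => [|k IHk]; first by rewrite addn0 pres_mod.
rewrite IHk (presS x (n + k)) addnS.
move: (x _) => a; rewrite [in RHS](divz_eq a (q (n + k))) expnD PoszM.
by rewrite [q n * _]mulrC mulrA modzMDl.
Qed.

Lemma pmul_eq0 (x y : Z_p) : x * y = 0 -> (x == 0) || (y == 0).
Proof.
move=> xy0; apply: contraT; rewrite negb_or => /andP[x0 y0].
have ex (z : Z_p) : z != 0 -> exists n, z n != 0.
  move=> z0; apply: contrapT => h; case/eqP: z0; apply: pres_eq => n.
  by rewrite pres0; apply/eqP/negPn/negP => zn; apply: h; exists n.
have [n xn] := ex _ x0; have [k yk] := ex _ y0.
have /eqP : (x * y) (n + k)%N = 0 by rewrite xy0 pres0.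
rewrite /= => /eqP/dvdz_mod0P.
have := pres_dvd x n k; have := pres_dvd y k n; rewrite (addnC k).
move: (x _) (y _) => a b.
rewrite (negbTE xn) (negbTE yk) !dvdzE abszM !absz_nat.
have [->|a0] := posnP `|a|%N; first by rewrite !dvdn0.
have [->|b0] := posnP `|b|%N; first by rewrite !dvdn0.
rewrite /= !pfactor_dvdn ?muln_gt0 ?a0 // lognM //.
move/negbT; rewrite -ltnNge => kb /negbT; rewrite -ltnNge => na.
by rewrite leqNgt (leq_trans _ (leq_add na (ltnW kb))).
Qed.

HB.instance Definition _ := GRing.ComUnitRing_isIntegral.Build Z_p pmul_eq0.

End PadicIntRing.

Notation padic p_pr := {fraction (padic_int p_pr)}.

Local Notation "x %:F" := (tofrac x) : ring_scope.

Section Padic.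
Variables (p : nat) (p_pr : prime p).
Local Notation Z_p := (padic_int p_pr).
Local Notation Q_p := (padic p_pr).

(* The valuation of a nonzero x is the least n such that x is nonzero modulo
   p^(n+1); the value at 0 is irrelevant. *)
Definition zval (x : Z_p) : nat :=
  if pselect (exists n, x n.+1 != 0) is left ex then ex_minn ex else 0%N.

(* ord_p on Q_p, normalized by ord_p(p) = 1 and with ord_p(0) = +oo; it takes
   values in the extended rationals since it is compared with multiples of
   c_p. *)
Definition ordp (x : Q_p) : \bar rat :=
  if x == 0 then +oo%E
  else ((zval \n_(repr x))%:R - (zval \d_(repr x))%:R)%:E.

Definition cvgp (u : nat -> Q_p) (l : Q_p) : Prop :=
  forall k : nat, exists N : nat, forall n : nat,
    (N <= n)%N -> (k%:R%:E <= ordp (u n - l)%R)%E.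

(* The sum of a p-adic series (0 if it diverges). *)
Definition psum (u : nat -> Q_p) : Q_p :=
  xget 0 [set l | cvgp (fun N => \sum_(n < N) u n) l].

Definition in_pZp (x : Z_p) : Prop := exists y : Z_p, x = p%:R * y.

Definition in_Zp (x : Q_p) : Prop := exists y : Z_p, x = y%:F.

Definition teichmuller (a : Z_p) : Z_p :=
  xget 0 [set w | w ^+ p.-1 = 1 /\ in_pZp (w - a)].

Definition logp (x : Q_p) : Q_p :=
  psum (fun n => (-1) ^+ n * (x - 1) ^+ n.+1 / n.+1%:R).

(* gamma lies in the group 1 + p Z_p and its integral powers are dense there. *)
Definition topological_generator (gamma : Z_p) : Prop :=
  in_pZp (gamma - 1) /\
  forall y : Z_p, in_pZp (y - 1) ->
    forall k : nat, exists n : int, (k%:R%:E <= ordp (gamma%:F ^ n - y%:F)%R)%E.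

Definition log_base (gamma x : Q_p) : Q_p := logp x / logp gamma.

Definition binomp (l : Q_p) (n : nat) : Q_p :=
  (\prod_(k < n) (l - k%:R)) / n`!%:R.

Definition kernelK (gamma a c : Z_p) (m : nat) (z w : Z_p) : Q_p :=
  (teichmuller a)%:F ^+ m *
  psum (fun n =>
    binomp (log_base gamma%:F ((a + c * z)%:F / (teichmuller a)%:F)) n
    * (p%:R * w%:F) ^+ n).

Definition c_p : rat := 1 - 1 / (p%:R - 1).

(* Power series in one (resp. two) variables are given by their coefficients. *)
Definition tate1 (f : nat -> Q_p) : Prop := cvgp f 0.

Definition tate2 (alpha : nat -> nat -> Q_p) : Prop :=
  forall k : nat, exists N : nat, forall i j : nat,
    (N <= i + j)%N -> (k%:R%:E <= ordp (alpha i j))%E.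

Definition tate_Zp (f : nat -> Q_p) : Prop :=
  tate1 f /\ forall n, in_Zp (f n).

Definition S_series (g : nat -> Q_p) : Prop :=
  tate1 g /\ forall n : nat, ((n%:R * c_p)%:E <= ordp (g n))%E.

(* The completed tensor product of Z_p<z> and S_w, realized in Q_p<z, w> as the
   closure, for the Gauss norm, of the span of the products f(z) g(w) with f in
   Z_p<z> and g in S_w. *)
Definition tate_Zp_tensor_S (alpha : nat -> nat -> Q_p) : Prop :=
  tate2 alpha /\
  forall k : nat, exists (n : nat) (f g : 'I_n -> nat -> Q_p),
    [/\ forall t, tate_Zp (f t),
        forall t, S_series (g t) &
        forall i j : nat,
          (k%:R%:E <= ordp (alpha i j - \sum_(t < n) f t i * g t j)%R)%E].

(* alpha is an element of Q_p<z, w> with sum F on Z_p x Z_p; by the identity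
   theorem the values of F there determine alpha. *)
Definition expands (F : Z_p -> Z_p -> Q_p) (alpha : nat -> nat -> Q_p) : Prop :=
  tate2 alpha /\
  forall z w : Z_p,
    cvgp (fun N => \sum_(i < N) \sum_(j < N) alpha i j * z%:F ^+ i * w%:F ^+ j)
         (F z w).

End Padic.

(* Main.v *)
From HB Require Import structures.
Require Import Defs.
From mathcomp Require Import all_boot all_order all_algebra.
From mathcomp Require Import ring zify.
From mathcomp Require Import boolp classical_sets constructive_ereal.

Set Implicit Arguments.
Unset Strict Implicit.
Unset Printing Implicit Defensive.

Import Order.TTheory GRing.Theory Num.Theory.
Local Open Scope ring_scope.

(** Write a = w (1 + p s) with w the Teichmuller representative and c = p c'.
   Since log (1 + p y) = p M(y) with M an integral power series whose
   coefficients tend to 0 and M(y) = y modulo p, and since gamma = 1 + p y0 with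
   y0 a unit, log_gamma ((a + c z) / w) = M(s + t z) / M(y0) is the sum L(z) of a
   series in Z_p<z>. The coefficient of w^j in the kernel is, up to a unit,
   (p^j / j!) L (L - 1) ... (L - j + 1), and Legendre's formula bounds ord_p (j!)
   by j / (p - 1). Every expansion has these coefficients by the identity
   theorem on Z_p x Z_p. *)

(** * The ideals p^k Z_p, completeness of Z_p, and its units *)

Section PadicIdeals.
Variables (p : nat) (p_pr : prime p).
Local Notation Z_p := (padic_int p_pr).
Local Notation q n := (p ^ n)%N%:Z.

(** The ideal p^k Z_p, tested on the single residue modulo p^k so that membership is boolean and
    closed under the generic subgroup lemmas. *)
Definition pideal (k : nat) : {pred Z_p} := [pred x : Z_p | x k == 0].

Fact pideal_zmod k : zmod_closed (pideal k).
Proof.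
split=> [|x y]; rewrite !inE ?pres0 // => /eqP x0 /eqP y0.
by rewrite /= y0 x0 oppr0 mod0z addr0 mod0z.
Qed.
HB.instance Definition _ k :=
  GRing.isZmodClosed.Build Z_p (pideal k) (pideal_zmod k).

Lemma pideal_mull k (x y : Z_p) : y \in pideal k -> x * y \in pideal k.
Proof. by rewrite !inE => /eqP y0; rewrite /= y0 mulr0 mod0z. Qed.

Lemma pideal_mulr k (x y : Z_p) : x \in pideal k -> x * y \in pideal k.
Proof. by move=> xk; rewrite mulrC pideal_mull. Qed.

Lemma pres_le (x : Z_p) n k : (n <= k)%N -> (x k %% q n)%Z = x n.
Proof.
move=> /subnK <-; elim: (k - n)%N => [|d IHd]; first by rewrite pres_mod.
rewrite -IHd [x (d + n)%N]presS addSn; move: (x _) => b.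
by rewrite [in LHS](divz_eq b (q (d + n))) expnD PoszM mulrA modzMDl.
Qed.

Lemma pideal_le n k (x : Z_p) : (n <= k)%N -> x \in pideal k -> x \in pideal n.
Proof. by rewrite !inE => /(pres_le x) <- /eqP ->; rewrite mod0z. Qed.

Lemma pideal0 (x : Z_p) : x \in pideal 0.
Proof. by rewrite inE -(pres_mod x) expn0 modz1. Qed.

Lemma pideal_eq0 (x : Z_p) : (forall k, x \in pideal k) -> x = 0.
Proof. by move=> x0; apply: pres_eq => k; rewrite pres0; apply/eqP/x0. Qed.

Lemma pres_nat m n : (m%:R : Z_p) n = (m%:Z %% q n)%Z.
Proof.
elim: m => [|m IHm]; first by rewrite pres0 mod0z.
by rewrite -addn1 natrD PoszD /= IHm modzDmr modzDml.
Qed.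

Lemma pidealP k (x : Z_p) :
  reflect (exists y : Z_p, x = p%:R ^+ k * y) (x \in pideal k).
Proof.
apply: (iffP idP) => [xk|[y ->]]; last first.
  by rewrite inE -natrX /= pres_nat modzz mul0r mod0z.
have dv n : (q k %| x (n + k)%N)%Z by rewrite addnC pres_dvd.
have qk0 := q_neq0 p_pr k.
(* The residue of x / p^k modulo p^n is read off from the residue of x modulo p^(n+k), divided by
   p^k. *)
have comp n : (x (n + k)%N %/ q k)%Z = ((x (n.+1 + k)%N %/ q k)%Z %% q n)%Z.
  have xE : x (n.+1 + k)%N = ((x (n.+1 + k)%N %/ q k)%Z * q k) by rewrite divzK.
  have := presS x (n + k); rewrite -addSn xE; move: (_ %/ _)%Z => b ->.
  rewrite [in LHS](divz_eq b (q n)) mulrDl -mulrA -PoszM -expnD modzMDl.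
  rewrite modz_small ?mulzK // mulr_ge0 ?modz_ge0 ?q_neq0 //=.
  by rewrite expnD PoszM ltr_pM2r ?ltz_pmod // ltz_nat expn_gt0 prime_gt0.
exists (PadicInt p_pr comp); apply: pres_eq => n.
rewrite -natrX /= pres_nat modzMml mulrC divzK // pres_le //.
exact: leq_addr.
Qed.

Lemma pideal_mul j k (x y : Z_p) :
  x \in pideal j -> y \in pideal k -> x * y \in pideal (j + k).
Proof.
move=> /pidealP[x' ->] /pidealP[y' ->]; apply/pidealP; exists (x' * y').
by rewrite exprD mulrACA.
Qed.

Lemma pideal_exp k : p%:R ^+ k \in pideal k.
Proof. by apply/pidealP; exists 1; rewrite mulr1. Qed.

Definition zcvg (u : nat -> Z_p) (l : Z_p) : Prop :=
  forall k, exists N, forall n, (N <= n)%N -> u n - l \in pideal k.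

Lemma zcauchy_cvg (u : nat -> Z_p) :
  (forall k, exists N, forall n, (N <= n)%N -> u n - u N \in pideal k) ->
  exists l, zcvg u l.
Proof.
move=> /choice[N uN].
have eqk k n : (N k <= n)%N -> u n k = u (N k) k.
  move=> /uN h; have := congr1 (fun x : Z_p => x k) (subrK (u (N k)) (u n)).
  by move: h; rewrite inE => /eqP /= -> <-; rewrite add0r pres_mod.
(* The residue of the limit modulo p^k is the one at which [u] becomes constant; beyond both
   thresholds, levels k and k+1 can be compared. *)
have comp k : u (N k) k = (u (N k.+1) k.+1 %% q k)%Z.
  rewrite -presS -(eqk k (maxn (N k) (N k.+1))) ?leq_maxl //.
  by rewrite [LHS]presS (eqk k.+1) ?leq_maxr // -presS.
exists (PadicInt p_pr comp) => k; exists (N k) => n /eqk eqn.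
by rewrite inE /= eqn modzDmr subrr mod0z.
Qed.

Lemma zcauchyS_cvg (u : nat -> Z_p) :
  (forall n, u n.+1 - u n \in pideal n) -> exists l, zcvg u l.
Proof.
move=> uS; apply: zcauchy_cvg => k; exists k => n /subnK <-.
elim: (n - k)%N => [|d IHd]; first by rewrite subrr rpred0.
rewrite addSn -(subrKA (u (d + k)%N)) rpredD //.
exact: pideal_le (leq_addl _ _) (uS _).
Qed.

Lemma zseries_cvg (u : nat -> Z_p) : zcvg u 0 ->
  exists l, zcvg (fun n => \sum_(i < n) u i) l.
Proof.
move=> u0; apply: zcauchy_cvg => k; have [N uN] := u0 k.
exists N => n /subnKC <-; rewrite big_split_ord /= [X in X - _]addrC addrK rpred_sum // => i _.
by rewrite -[u _]subr0 uN ?leq_addr.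
Qed.

Lemma zcvgMl (x : Z_p) u l : zcvg u l -> zcvg (fun n => x * u n) (x * l).
Proof.
by move=> ul k; have [N uN] := ul k; exists N => n /uN h; rewrite -mulrBr pideal_mull.
Qed.

Lemma pideal_lim k u l N : zcvg u l ->
  (forall n, (N <= n)%N -> u n \in pideal k) -> l \in pideal k.
Proof.
move=> ul uk; have [N' uN'] := ul k.
rewrite -[l](subKr (u (maxn N N'))) rpredB ?uk ?uN' ?leq_maxl ?leq_maxr //.
Qed.

(** Bezout gives an inverse of x modulo each p^n. Such inverses are unique modulo p^n, so they form
    a Cauchy sequence, and its limit inverts x. *)
Lemma padic_unit (x : Z_p) : x \notin pideal 1 -> x \is a GRing.unit.
Proof.
move=> x1; have cop n : coprimez (x n) (q n).
  case: n => [|n]; first by rewrite coprimezE coprimen1.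
  rewrite coprimezE absz_nat coprime_pexpr // coprime_sym.
  rewrite prime_coprime //; apply: contra x1 => xp.
  by rewrite inE -(pres_le x (ltn0Sn n)) expn1; apply/eqP/dvdz_mod0P; rewrite dvdzE.
have /choice[u uP] : forall n, exists b : Z_p, b * x - 1 \in pideal n.
  move=> n; have /coprimezP[[b d] /= bd] := cop n.
  exists (pcst p_pr b); rewrite inE /= modzMml modzNm modzDml modzDmr.
  have -> : b * x n - 1 = - d * q n by rewrite -bd; ring.
  by rewrite modzMl.
have [n|y uy] := @zcauchyS_cvg u.
  have -> : u n.+1 - u n = u n * (u n.+1 * x - 1) - u n.+1 * (u n * x - 1) by ring.
  by apply: rpredB; apply: pideal_mull => //; apply: pideal_le (leqnSn n) _.
apply/unitrP; suff yx : y * x = 1 by exists y; split=> //; rewrite mulrC.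
apply/subr0_eq/pideal_eq0 => k; have [N uN] := uy k.
have -> : y * x - 1 = (u (maxn N k) * x - 1) - (u (maxn N k) - y) * x by ring.
rewrite rpredB ?pideal_mulr ?uN ?leq_maxl //.
exact: pideal_le (leq_maxr _ _) (uP _).
Qed.

Lemma unit_pideal1 (x : Z_p) : (x \is a GRing.unit) = (x \notin pideal 1).
Proof.
apply/idP/idP => [xU|/padic_unit//]; apply/negP => /(pideal_mull x^-1).
rewrite mulVr // inE (pres_nat 1 1) expn1 modz_small //=.
by rewrite ltz_nat prime_gt1.
Qed.

Lemma natr_unit m : (0 < m)%N ->
  exists2 u : Z_p, u \is a GRing.unit & m%:R = p%:R ^+ logn p m * u.
Proof.
(* The unit is the prime-to-p part of m. *)
move=> m0; exists (m`_p^')%:R; last first.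
  by rewrite -natrX -natrM -p_part partnC.
rewrite unit_pideal1 inE pres_nat expn1; apply/negP => /eqP/dvdz_mod0P.
rewrite dvdzE /= => pm; have := part_pnat p^' m.
by rewrite p'natE // pm.
Qed.

End PadicIdeals.

(** * Valuations on Z_p and Q_p, limits and sums of p-adic series *)

Section Valuation.
Variables (p : nat) (p_pr : prime p).
Local Notation Z_p := (padic_int p_pr).
Local Notation Q_p := (padic p_pr).

Lemma zval_pideal (x : Z_p) k : x != 0 -> (x \in pideal k) = (k <= zval x)%N.
Proof.
move=> x0; rewrite /zval; case: pselect => [ex|[]]; last first.
  apply: contrapT => h; case/eqP: x0; apply: pideal_eq0 => -[|n].
    exact: pideal0.
  by apply/negPn/negP => xn; apply: h; exists n.
case: ex_minnP => v xv vmin; apply/idP/idP => [xk|].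
  rewrite leqNgt; apply/negP => vk; case/negP: xv; rewrite -[_ == _]/(x \in pideal v.+1).
  exact: pideal_le xk.
move/pideal_le; apply; case: v {xv} vmin => [|v] vmin; first exact: pideal0.
by apply/negPn/negP => /vmin; rewrite ltnn.
Qed.

Lemma zval_expM n (u : Z_p) : u \is a GRing.unit ->
  p%:R ^+ n * u != 0 /\ zval (p%:R ^+ n * u) = n.
Proof.
move=> uU; have nin : p%:R ^+ n * u \notin pideal n.+1.
  apply/negP => /pidealP[y]; rewrite exprSr -mulrA => /(mulfI _) uE.
  move: uU; rewrite uE ?unit_pideal1 ?pideal_mulr ?(pideal_exp p_pr 1) //.
  (* Cancelling p^n requires p to be nonzero in Z_p, which is visible modulo p^2. *)
  rewrite expf_eq0; apply/nandP; right; apply/negP => /eqP p0.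
  have := pres_nat p_pr p 2; rewrite p0 pres0 modz_small; first by case: (p) p_pr.
  by rewrite /= ltz_nat -[X in (X < _)%N]expn1 ltn_exp2l ?prime_gt1.
have nz : p%:R ^+ n * u != 0.
  by apply: contraNneq nin => ->; apply: rpred0.
split=> //; apply/eqP; rewrite eqn_leq -zval_pideal // pideal_mulr ?pideal_exp //.
by rewrite andbT leqNgt -zval_pideal.
Qed.

Lemma zval_unit (x : Z_p) : x != 0 ->
  exists2 u : Z_p, u \is a GRing.unit & x = p%:R ^+ zval x * u.
Proof.
move=> x0; have /pidealP[y xE] : x \in pideal (zval x) by rewrite zval_pideal.
exists y => //; rewrite unit_pideal1; apply/negP => y1.
have := pideal_mul (pideal_exp p_pr (zval x)) y1.
by rewrite -xE zval_pideal // addn1 ltnn.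
Qed.

Lemma zvalM (x y : Z_p) : x != 0 -> y != 0 -> zval (x * y) = (zval x + zval y)%N.
Proof.
move=> /zval_unit[u uU xE] /zval_unit[v vU yE].
rewrite [in LHS]xE [in LHS]yE mulrACA -exprD.
by have [] := @zval_expM (zval x + zval y) (u * v); rewrite ?unitrM ?uU.
Qed.

(** [ordp] is computed on a chosen representative; this turns that choice into an equation in the
    field. *)
Lemma fraction_numden (R : idomainType) (x : {fraction R}) :
  x * tofrac (\d_(repr x)) = tofrac (\n_(repr x)).
Proof.
rewrite -[X in X * _ = _]reprK; move: (repr x) => r.
unlock FracField.tofrac; rewrite -[LHS]FracField.pi_mul.
apply/eqmodP; rewrite /= FracField.equivfE.
by rewrite !numden_Ratio ?(oner_eq0, mulf_neq0) ?denom_ratioP // !mulr1 mulrC.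
Qed.

(** Carries estimates from Q_p to the ideals of Z_p; for k = 0 it says that nonnegative valuation
    means lying in Z_p. Additivity of [zval] makes the choice of fraction harmless. *)
Lemma ordp_ge_nat k (x : Q_p) : (k%:R%:E <= ordp x)%E <->
  exists2 y : Z_p, y \in pideal k & x = tofrac y.
Proof.
rewrite /ordp; case: eqVneq => [->|x0].
  by split=> [_|_]; rewrite ?leey //; exists 0; rewrite ?rpred0 ?tofrac0.
have d0 : \d_(repr x) != 0 by exact: denom_ratioP.
have xE := fraction_numden x.
have n0 : \n_(repr x) != 0 by rewrite -tofrac_eq0 -xE mulf_neq0 ?tofrac_eq0.
move: (\n_(repr x)) (\d_(repr x)) n0 d0 xE => n d n0 d0 xE.
rewrite lee_fin lerBrDr -natrD ler_nat; split=> [le|[y yk xy]]; last first.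
  have /eqP := xE; rewrite xy -tofracM tofrac_eq => /eqP yE.
  have y0 : y != 0 by apply: contraNneq n0 => y0; rewrite -yE y0 mul0r.
  by rewrite -yE zvalM // leq_add2r -zval_pideal.
have [u uU nE] := zval_unit n0; have [v vU dE] := zval_unit d0.
exists (p%:R ^+ (zval n - zval d) * (u / v)).
  rewrite pideal_mulr //; apply: pideal_le (pideal_exp _ _).
  by rewrite leq_subRL ?(leq_trans (leq_addl _ _) le) // addnC.
apply: (mulIf (x := tofrac d)); first by rewrite tofrac_eq0.
rewrite xE -tofracM; congr tofrac; rewrite [LHS]nE [X in _ = _ * X]dE mulrACA -exprD.
by rewrite subnK ?divrK // (leq_trans (leq_addl _ _) le).
Qed.

Lemma cvgp_tofrac (u : nat -> Z_p) l :
  zcvg u l -> cvgp (fun n => tofrac (u n)) (tofrac l).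
Proof.
move=> ul k; have [N uN] := ul k; exists N => n /uN h.
by apply/ordp_ge_nat; exists (u n - l); rewrite // tofracB.
Qed.

Lemma ordp_geB k (x y : Q_p) : (k%:R%:E <= ordp x)%E -> (k%:R%:E <= ordp y)%E ->
  (k%:R%:E <= ordp (x - y)%R)%E.
Proof.
move=> /ordp_ge_nat[x' x'k ->] /ordp_ge_nat[y' y'k ->]; apply/ordp_ge_nat.
by exists (x' - y'); rewrite ?rpredB ?tofracB.
Qed.

Lemma ordp_inf_eq0 (x : Q_p) : (forall k, (k%:R%:E <= ordp x)%E) -> x = 0.
Proof.
move=> xk; have /ordp_ge_nat[y _ xy] := xk 0%N; rewrite xy.
rewrite (_ : y = 0) ?tofrac0 //; apply: pideal_eq0 => k.
have /ordp_ge_nat[z zk] := xk k; rewrite xy => /eqP.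
by rewrite tofrac_eq => /eqP ->.
Qed.

Lemma cvgp_unique (u : nat -> Q_p) l l' : cvgp u l -> cvgp u l' -> l = l'.
Proof.
move=> ul ul'; apply/subr0_eq/ordp_inf_eq0 => k.
have [N uN] := ul k; have [N' uN'] := ul' k.
have -> : l - l' = (u (maxn N N') - l') - (u (maxn N N') - l).
  by ring.
by rewrite ordp_geB ?uN ?uN' ?leq_maxl ?leq_maxr.
Qed.

Lemma psumE (u : nat -> Q_p) l : cvgp (fun N => \sum_(n < N) u n) l -> psum u = l.
Proof.
move=> ul; have := @xgetPex _ 0 [set l | cvgp (fun N => \sum_(n < N) u n) l].
by move=> /(_ (ex_intro _ l ul)) /cvgp_unique; apply.
Qed.

Lemma psum_tofrac (u : nat -> Z_p) l :
  zcvg (fun n => \sum_(i < n) u i) l -> psum (fun n => tofrac (u n)) = tofrac l.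
Proof.
move=> /cvgp_tofrac ul; apply: psumE; congr (cvgp _ _): ul.
by apply/funext => n; rewrite rmorph_sum.
Qed.
End Valuation.

(** * Bounds for the valuations of n! and n + 1 *)

Lemma logn_fact_ub p n : prime p -> (p.-1 * logn p n`! <= n)%N.
Proof.
move=> p_pr; rewrite logn_fact //.
(* The extra term makes the sum telescope: with q = floor(n / p^(m+1)), one has (p - 1) q + q = p q
   <= floor(n / p^m). *)
suff H m : (p.-1 * (\sum_(1 <= k < m.+1) n %/ p ^ k) + n %/ p ^ m <= n)%N.
  by apply: leq_trans (H n); exact: leq_addr.
elim: m => [|m IHm]; first by rewrite big_geq // muln0 add0n expn0 divn1.
apply: leq_trans IHm; rewrite big_nat_recr //= mulnDr -addnA leq_add2l.
rewrite -mulSnr prednK ?prime_gt0 // expnSr divnMA mulnC.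
exact: leq_trunc_div.
Qed.

(** If v is the valuation of n + 1, then p^v <= n + 1, while 2 v < p^v because p >= 3. *)
Lemma logn_succ_ub p n : odd p -> prime p -> ((logn p n.+1).*2 <= n)%N.
Proof.
move=> p_odd p_pr; have p3 : (2 < p)%N by apply: odd_prime_gt2.
rewrite -ltnS; apply: leq_trans (dvdn_leq (ltn0Sn n) (pfactor_dvdnn p n.+1)).
elim: (logn _ _) => [|v IHv] //; rewrite expnS doubleS.
apply: leq_trans (leq_mul p3 IHv); rewrite mulSn; lia.
Qed.

(** * Integral coefficients for the logarithm, and Teichmuller representatives *)

Section Coefficients.
Variables (p : nat) (p_pr : prime p).
Local Notation Z_p := (padic_int p_pr).
Local Notation Q_p := (padic p_pr).
Implicit Types (x y z l : Z_p).

Lemma pnatr_eq0 m : (m%:R == 0 :> Z_p) = (m == 0%N).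
Proof.
case: m => [|m]; first by rewrite !eqxx.
have [u uU ->] := natr_unit p_pr (ltn0Sn m).
by have [/negbTE] := zval_expM (logn p m.+1) uU.
Qed.

Lemma pexp_divn n m : (0 < m)%N -> (logn p m <= n)%N ->
  exists2 e : Z_p, e \in pideal (n - logn p m) & e * m%:R = p%:R ^+ n.
Proof.
move=> m0 mn; have [u uU mE] := natr_unit p_pr m0.
exists (p%:R ^+ (n - logn p m) / u); first by rewrite pideal_mulr ?pideal_exp.
by rewrite mE mulrACA -exprD subnK // mulVr ?mulr1.
Qed.

(** The sequence is p^n / n!, integral because Legendre's bound gives ord_p(n!) <= n. *)
Lemma fact_coef : odd p -> exists e : nat -> Z_p, forall n,
  e n * n`!%:R = p%:R ^+ n /\ e n \in pideal (n - logn p n`!).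
Proof.
move=> p_odd; have /choice[e eP] : forall n, exists e : Z_p,
    e * n`!%:R = p%:R ^+ n /\ e \in pideal (n - logn p n`!).
  move=> n; have [||e e1 e2] := @pexp_divn n n`!; last by exists e.
    exact: fact_gt0.
  apply: leq_trans (logn_fact_ub n p_pr); apply: leq_pmull.
  by rewrite -ltnS prednK ?prime_gt0 ?prime_gt1.
by exists e.
Qed.

(** [mu n] is the coefficient of y^(n+1) in log(1 + p y) / p. Its valuation is at least n / 2
    because ord_p(n + 1) <= n / 2. *)
Lemma log_coef : odd p -> exists mu : nat -> Z_p,
  [/\ mu 0%N = 1, forall n, mu n \in pideal (uphalf n) &
      forall n, mu n * n.+1%:R = (-1) ^+ n * p%:R ^+ n].
Proof.
move=> p_odd; have /choice[e eP] : forall n, exists e : Z_p,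
    e * n.+1%:R = p%:R ^+ n /\ e \in pideal (uphalf n).
  move=> n; have := logn_succ_ub n p_odd p_pr => lt.
  have [||e e1 e2] := @pexp_divn n n.+1 => //; first by lia.
  by exists e; split=> //; apply: pideal_le e1; lia.
exists (fun n => (-1) ^+ n * e n); split=> [|n|n].
- by have [+ _] := eP 0%N; rewrite !mulr1 mul1r.
- by rewrite pideal_mull //; case: (eP n).
by rewrite -mulrA; case: (eP n) => ->.
Qed.

(** Each term (-1)^n (p y)^(n+1) / (n + 1) of the logarithm is p times a term of the integral series
    with coefficients [mu]. *)
Lemma logp_series (mu : nat -> Z_p) y l :
  (forall n, mu n * n.+1%:R = (-1) ^+ n * p%:R ^+ n) ->
  zcvg (fun n => \sum_(i < n) mu i * y ^+ i.+1) l ->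
  logp (tofrac (1 + p%:R * y)) = tofrac (p%:R * l).
Proof.
move=> muE yl; rewrite /logp -[RHS](@psum_tofrac _ _ (fun n => p%:R * (mu n * y ^+ n.+1))).
  congr psum; apply/funext => n; have n0 : n.+1%:R != 0 :> Q_p.
    by rewrite -(rmorph_nat (@tofrac Z_p)) tofrac_eq0 pnatr_eq0.
  apply: (mulIf n0); rewrite divfK // -tofrac1 -tofracB addrC addKr.
  rewrite -(rmorph_nat (@tofrac Z_p) n.+1) -tofracN -!tofracXn -!tofracM.
  congr tofrac; rewrite exprMn exprS mulrCA; have := muE n.
  move: (mu n) (n.+1%:R) ((-1) ^+ n) (p%:R ^+ n) (y ^+ n.+1) => a b s t v abE.
  by transitivity (p%:R * v * (s * t)); [ring | rewrite -abE; ring].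
have := zcvgMl p%:R yl; congr (zcvg _ _); apply/funext => n; exact: mulr_sumr.
Qed.

Lemma zseries_tail k N (u : nat -> Z_p) l : zcvg (fun n => \sum_(i < n) u i) l ->
  (forall i, (N <= i)%N -> u i \in pideal k) -> l - \sum_(i < N) u i \in pideal k.
Proof.
move=> ul uk; have [N' uN'] := ul k; have := uN' _ (leq_addl N N').
rewrite big_split_ord /= => h.
set a := \sum_(i < N) _ in h *; set b := \sum_(i < N') _ in h.
have -> : l - a = b - (a + b - l) by ring.
by rewrite rpredB // rpred_sum // => i _; rewrite uk ?leq_addr.
Qed.

Lemma in_pZpE x : in_pZp x <-> x \in pideal 1.
Proof. by split=> [[y ->]|/pidealP[y ->]]; [apply/pidealP|]; exists y; rewrite ?expr1. Qed.

(** Reduces to a natural number congruent to x modulo p, where Fermat's little theorem applies. *)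
Lemma fermat_padic x : x ^+ p - x \in pideal 1.
Proof.
pose m := absz (x 1%N); have xm : x - m%:R \in pideal 1.
  have x1 : 0 <= x 1%N by rewrite -(pres_mod x) modz_ge0 ?q_neq0.
  by rewrite inE /= pres_nat gez0_abs // modzNm modzDmr subrr mod0z.
have -> : x ^+ p - x = (x ^+ p - m%:R ^+ p) + (m%:R ^+ p - m%:R) - (x - m%:R) by ring.
rewrite rpredB // rpredD //; first by rewrite subrXX pideal_mulr.
have mp : ((m ^ p)%:R : Z_p) 1%N = (m%:R : Z_p) 1%N.
  by rewrite !pres_nat !modz_nat expn1 fermat_little.
by rewrite -natrX inE /= mp modzDmr subrr mod0z.
Qed.

Lemma pideal_exprp k x y : x - y \in pideal k.+1 -> x ^+ p - y ^+ p \in pideal k.+2.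
Proof.
move=> xy; rewrite subrXX -(addn1 k.+1); apply: pideal_mul => //.
(* The cofactor of x - y has p terms, each congruent to x^(p-1) modulo p, so it is divisible by p
   and one power of p is gained. *)
have -> : \sum_(i < p) x ^+ (p.-1 - i) * y ^+ i =
  \sum_(i < p) x ^+ (p.-1 - i) * (y ^+ i - x ^+ i) + p%:R * x ^+ p.-1.
  have -> : p%:R * x ^+ p.-1 = \sum_(i < p) x ^+ p.-1.
    by rewrite sumr_const card_ord mulr_natl.
  rewrite -big_split; apply: eq_bigr => i _ /=.
  rewrite mulrBr -exprD subnK ?subrK //.
  by rewrite -ltnS prednK ?prime_gt0.
rewrite rpredD //; last by rewrite pideal_mulr // (pideal_exp p_pr 1).
rewrite rpred_sum // => i _; rewrite pideal_mull // subrXX pideal_mulr //.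
by rewrite -opprB rpredN (pideal_le _ xy).
Qed.

(** The powers a^(p^n) converge: consecutive ones agree modulo p^(n+1), by Fermat and then by
    repeated p-th powers. The limit is fixed by the p-th power map and congruent to a, so the set
    from which [teichmuller] chooses is inhabited. *)
Lemma teichmullerP (a : Z_p) : a \is a GRing.unit ->
  teichmuller a ^+ p.-1 = 1 /\ teichmuller a - a \in pideal 1.
Proof.
move=> aU; have aS n : a ^+ (p ^ n.+1) = (a ^+ (p ^ n)) ^+ p.
  by rewrite expnSr exprM.
have uS n : a ^+ (p ^ n.+1) - a ^+ (p ^ n) \in pideal n.+1.
  elim: n => [|n IHn]; first by rewrite expn0 expn1 expr1 fermat_padic.
  by rewrite (aS n.+1) [X in _ - X]aS pideal_exprp.
have [n|w wl] := @zcauchyS_cvg _ p_pr (fun n => a ^+ (p ^ n)).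
  exact: pideal_le (uS n).
have w1 : w - a \in pideal 1.
  apply: (@pideal_lim _ _ _ (fun n => a ^+ (p ^ n) - a) _ 0).
    by move=> k; have [N wN] := wl k; exists N => n /wN; rewrite opprB addrA subrK.
  move=> n _; elim: n => [|n IHn]; first by rewrite expn0 expr1 subrr rpred0.
  by rewrite -(subrKA (a ^+ (p ^ n))) rpredD // (pideal_le _ (uS n)).
have wU : w \is a GRing.unit.
  rewrite unit_pideal1; apply: contraTN aU => w1'.
  by rewrite unit_pideal1 negbK -[a](subKr w) rpredB.
have wp : w ^+ p = w.
  apply/subr0_eq/pideal_eq0 => k; have [N wN] := wl k.
  (* Both w and w^p are close to a^(p^(N+1)), the latter as the p-th power of a^(p^N). *)
  have -> : w ^+ p - w = (a ^+ (p ^ N.+1) - w) - (a ^+ (p ^ N.+1) - w ^+ p) by ring.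
  rewrite rpredB ?wN //; rewrite aS subrXX pideal_mulr // wN //.
have wp1 : w ^+ p.-1 = 1.
  by apply: (mulIr wU); rewrite mul1r -exprSr prednK ?prime_gt0.
have [] := @xgetPex _ 0 [set w | w ^+ p.-1 = 1 /\ in_pZp (w - a)].
  by exists w; split=> //; apply/in_pZpE.
by move=> ? /in_pZpE.
Qed.
End Coefficients.

(** * Power series in Z_p<z> and the functions they define on Z_p *)

Section TateFunctions.
Variables (p : nat) (p_pr : prime p).
Local Notation Z_p := (padic_int p_pr).
Local Notation Q_p := (padic p_pr).
Implicit Types (f g : nat -> Z_p) (F G : Z_p -> Z_p) (P : {poly Z_p}).

(* f is the coefficient sequence of a power series in Z_p<z> with sum F on Z_p:
   modulo each p^k, it is a polynomial. *)
Definition tate_rep f F : Prop := forall k, exists P,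
  (forall i, f i - P`_i \in pideal k) /\ (forall z, F z - P.[z] \in pideal k).

Lemma tate_rep_cst (x : Z_p) : tate_rep (fun i => x%:P`_i) (fun=> x).
Proof.
by move=> k; exists x%:P; split=> *; rewrite ?hornerC subrr rpred0.
Qed.

Lemma tate_repB f g F G : tate_rep f F -> tate_rep g G ->
  tate_rep (fun i => f i - g i) (fun z => F z - G z).
Proof.
move=> fF gG k; have [P [fP FP]] := fF k; have [Q [gQ GQ]] := gG k.
by exists (P - Q); split=> *; rewrite ?coefB ?hornerE opprD addrACA -opprD rpredB.
Qed.

Lemma tate_repM f g F G : tate_rep f F -> tate_rep g G ->
  tate_rep (fun i => \sum_(j < i.+1) f j * g (i - j)%N) (fun z => F z * G z).
Proof.
move=> fF gG k; have [P [fP FP]] := fF k; have [Q [gQ GQ]] := gG k.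
have modM (a b c d : Z_p) : a - c \in pideal k -> b - d \in pideal k ->
    a * b - c * d \in pideal k.
  move=> ac bd; have -> : a * b - c * d = (a - c) * b + c * (b - d) by ring.
  by apply: rpredD; [apply: pideal_mulr | apply: pideal_mull].
exists (P * Q); split=> [i|z]; last by rewrite hornerM modM.
by rewrite coefM -sumrB rpred_sum // => j _; apply: modM.
Qed.

(** Since the coefficients tend to 0 uniformly in the degree, the sum of the first N terms serves as
    the polynomial modulo p^k, both for coefficients and for values. *)
Lemma tate_rep_series (T : nat -> {poly Z_p}) F :
  (forall k, exists N, forall n i, (N <= n)%N -> (T n)`_i \in pideal k) ->
  (forall z, zcvg (fun n => \sum_(i < n) (T i).[z]) (F z)) ->
  exists f, tate_rep f F.
Proof.
move=> T0 TF.
have /choice[f fP] : forall i, exists l, zcvg (fun n => \sum_(j < n) (T j)`_i) l.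
  move=> i; apply: (zseries_cvg (u := fun j => (T j)`_i)) => k; have [N TN] := T0 k.
  by exists N => n Nn; rewrite subr0 TN.
exists f => k; have [N TN] := T0 k; exists (\sum_(j < N) T j).
split=> [i|z].
  by rewrite coef_sum; apply: (zseries_tail (u := fun j => (T j)`_i)) => // n /TN.
rewrite horner_sum; apply: (zseries_tail (u := fun i => (T i).[z])) => // n Nn.
by rewrite horner_coef rpred_sum // => i _; rewrite pideal_mulr // TN.
Qed.

Lemma tate_rep_cvg f F k : tate_rep f F -> exists N, forall n, (N <= n)%N ->
  f n \in pideal k /\ forall z, \sum_(i < n) f i * z ^+ i - F z \in pideal k.
Proof.
move=> /(_ k)[P [fP FP]]; exists (size P) => n Pn; split=> [|z].
  by have := fP n; rewrite nth_default // subr0.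
rewrite -(subrKA P.[z]) rpredD //; last by rewrite -opprB rpredN.
rewrite (horner_coef_wide _ Pn) -sumrB rpred_sum // => i _.
by rewrite -mulrBl pideal_mulr.
Qed.

Lemma tate_rep_prod (f : nat -> nat -> Z_p) (F : nat -> Z_p -> Z_p) :
  (forall n, tate_rep (f n) (F n)) -> forall n,
  exists g, tate_rep g (fun z => \prod_(k < n) F k z).
Proof.
move=> fF; elim=> [|n [g gP]].
  by eexists; congr (tate_rep _ _): (tate_rep_cst 1); apply/funext => z; rewrite big_ord0.
eexists; congr (tate_rep _ _): (tate_repM gP (fF n)); apply/funext => z.
by rewrite big_ord_recr.
Qed.
End TateFunctions.

(** * The identity theorem for double series on Z_p x Z_p *)

Section IdentityTheorem.
Variables (p : nat) (p_pr : prime p).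
Local Notation Z_p := (padic_int p_pr).
Local Notation Q_p := (padic p_pr).

Lemma expp_neq0 k : p%:R ^+ k != 0 :> Z_p.
Proof. by rewrite expf_eq0 pnatr_eq0 (gtn_eqF (prime_gt0 p_pr)) andbF. Qed.

Lemma pideal_cancel j k (x : Z_p) :
  p%:R ^+ j * x \in pideal (j + k) -> x \in pideal k.
Proof.
move=> /pidealP[y]; rewrite exprD -mulrA => /(mulfI (expp_neq0 j)) ->.
by rewrite pideal_mulr ?pideal_exp.
Qed.

(* Substituting z = p^(k (j + 1)) and w = p^k makes the term of index (i, j)
   dominate all those that are larger for the lexicographic order. *)
Lemma double_series_eq0 (d : nat -> nat -> Z_p) :
  (forall z w, zcvg (fun N => \sum_(i < N) \sum_(j < N) d i j * z ^+ i * w ^+ j) 0) ->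
  forall i j, d i j = 0.
Proof.
move=> d0; elim/ltn_ind=> i IHi; elim/ltn_ind=> j IHj; apply: pideal_eq0 => k.
set z : Z_p := p%:R ^+ (k * j.+1); set w : Z_p := p%:R ^+ k.
set e := (k * (j.+1 * i + j))%N.
have tE i' j' : d i' j' * z ^+ i' * w ^+ j' = p%:R ^+ (k * (j.+1 * i' + j')) * d i' j'.
  by rewrite -mulrA -!exprM -exprD mulrC mulnDr mulnA.
(* Lexicographically smaller indices vanish by the two inductions. For i' > i the weight (j + 1) i'
   alone exceeds (j + 1) i + j, whatever j' is, so the term has at least k more factors p. *)
have tk i' j' : (i' != i) || (j' != j) -> d i' j' * z ^+ i' * w ^+ j' \in pideal (e + k).
  have small : (i < i')%N \/ i' = i /\ (j < j')%N -> (e + k <= k * (j.+1 * i' + j'))%N.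
    move=> lt; rewrite /e -mulnSr leq_mul2l; apply/orP; right; case: lt => [lt|[-> lt]].
      by rewrite -addnS -mulnSr; apply: leq_trans (leq_mul (leqnn _) lt) (leq_addr _ _).
    by rewrite -addnS leq_add2l.
  rewrite tE; case: (ltngtP i' i) => [lt _|lt _|ii /=].
  - by rewrite IHi // mulr0 rpred0.
  - by apply: pideal_mulr; apply: pideal_le (pideal_exp _ _); apply: small; left.
  case: (ltngtP j' j) => [lt _|lt _|//]; first by rewrite ii IHj // mulr0 rpred0.
  by apply: pideal_mulr; apply: pideal_le (pideal_exp _ _); apply: small; right.
have [N dN] := d0 z w (e + k)%N; have := dN _ (leq_maxl N (i + j).+1).
have iN : (i < maxn N (i + j).+1)%N by rewrite leq_max ltnS leq_addr orbT.
have jN : (j < maxn N (i + j).+1)%N by rewrite leq_max ltnS leq_addl orbT.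
(* Modulo p^(e+k) only p^e [d i j] is left of a partial sum that itself vanishes there, so p^k
   divides [d i j]. *)
rewrite subr0 (bigD1 (Ordinal iN)) //= (bigD1 (Ordinal jN)) //= tE -addrA.
rewrite rpredDr; first exact: pideal_cancel.
rewrite rpredD //; apply: rpred_sum; first by move=> j' ne; rewrite tk // orbC ne.
by move=> i' ne; apply: rpred_sum => j' _; rewrite tk // ne.
Qed.

Lemma ordp_denominator (x : Q_p) : exists B, (0%:R%:E <= ordp (p%:R ^+ B * x)%R)%E.
Proof.
have d0 : \d_(repr x) != 0 by exact: denom_ratioP.
have [u uU dE] := zval_unit d0; exists (zval (\d_(repr x))); apply/ordp_ge_nat.
exists (u^-1 * \n_(repr x)); first exact: pideal0.
rewrite tofracM -fraction_numden mulrCA mulrC; congr (_ * _).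
rewrite -(rmorph_nat (@tofrac Z_p)) -tofracXn -tofracM; congr tofrac.
by rewrite [in RHS]dE mulrCA mulVr ?mulr1.
Qed.

(** Only finitely many coefficients can have denominators; B is the largest exponent needed on the
    square i, j < N. *)
Lemma tate2_bounded (alpha : nat -> nat -> Q_p) : tate2 alpha ->
  exists B, forall i j, (0%:R%:E <= ordp (p%:R ^+ B * alpha i j)%R)%E.
Proof.
move=> /(_ 0%N)[N aN].
have mulX B (x : Q_p) : (0%:R%:E <= ordp x)%E -> (0%:R%:E <= ordp (p%:R ^+ B * x)%R)%E.
  move=> /ordp_ge_nat[y _ ->]; apply/ordp_ge_nat; exists (p%:R ^+ B * y).
    exact: pideal0.
  by rewrite tofracM tofracXn rmorph_nat.
have /choice[b bP] : forall ij, exists B, (0%:R%:E <= ordp (p%:R ^+ B * alpha ij.1 ij.2)%R)%E.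
  by move=> ij; apply: ordp_denominator.
exists (\max_(i < N) \max_(j < N) b (i : nat, j : nat)) => i j.
have [/aN/mulX//|lt] := leqP N (i + j)%N.
have iN : (i < N)%N by apply: leq_ltn_trans lt; apply: leq_addr.
have jN : (j < N)%N by apply: leq_ltn_trans lt; apply: leq_addl.
have : (b (i, j) <= \max_(i < N) \max_(j < N) b (i : nat, j : nat))%N.
  apply: leq_trans (leq_bigmax (Ordinal iN)) => /=.
  exact: leq_trans (leq_bigmax (Ordinal jN)).
by move=> /subnK <-; rewrite exprD -mulrA mulX // (bP (i, j)).
Qed.

(** The difference of the two expansions, multiplied by p^B to become integral, sums to 0 at every
    point of Z_p x Z_p. *)
Lemma expands_unique (F : Z_p -> Z_p -> Q_p) (alpha beta : nat -> nat -> Q_p) :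
  expands F alpha -> expands F beta -> forall i j, alpha i j = beta i j.
Proof.
move=> [a2 aF] [b2 bF].
have [|B dB] := @tate2_bounded (fun i j => alpha i j - beta i j).
  move=> k; have [N aN] := a2 k; have [N' bN'] := b2 k.
  exists (maxn N N') => i j; rewrite geq_max => /andP[/aN ? /bN' ?].
  exact: ordp_geB.
have /choice[d dP] : forall ij, exists x : Z_p,
    p%:R ^+ B * (alpha ij.1 ij.2 - beta ij.1 ij.2) = tofrac x.
  by move=> [i j]; have /ordp_ge_nat[x _ xE] := dB i j; exists x.
have d0 : forall i j, d (i, j) = 0.
  apply: (double_series_eq0 (d := fun i j => d (i, j))) => z w k.
  have [N aN] := aF z w k; have [N' bN'] := bF z w k.
  exists (maxn N N') => n; rewrite geq_max => /andP[/aN an /bN' bn].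
  have /ordp_ge_nat[y yk] := ordp_geB an bn.
  rewrite opprB addrA subrK -sumrB => yE.
  rewrite subr0 [X in X \in _](_ : _ = p%:R ^+ B * y) ?pideal_mull //.
  apply/eqP; rewrite -tofrac_eq tofracM -yE mulr_sumr rmorph_sum; apply/eqP.
  apply: eq_bigr => i _; rewrite -sumrB mulr_sumr rmorph_sum; apply: eq_bigr => j _.
  rewrite /= !tofracM -(dP (i : nat, j : nat)) !tofracXn rmorph_nat /=; ring.
move=> i j; apply/subr0_eq; have /eqP := dP (i, j); rewrite d0 tofrac0 /= mulf_eq0.
rewrite -(rmorph_nat (@tofrac Z_p)) -tofracXn tofrac_eq0 (negbTE (expp_neq0 B)).
by move/eqP.
Qed.
End IdentityTheorem.

(** * The logarithm to base gamma and the kernel as integral series in z *)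

Section Kernel.
Variables (p : nat) (p_pr : prime p).
Local Notation Z_p := (padic_int p_pr).
Local Notation Q_p := (padic p_pr).

Lemma unit_near1 (x : Z_p) : x - 1 \in pideal 1 -> x \is a GRing.unit.
Proof.
move=> x1; rewrite unit_pideal1; apply: contraTN (unitr1 Z_p) => xp.
by rewrite unit_pideal1 negbK -[1](subKr x) rpredB.
Qed.

(** If y were in p Z_p, all integral powers of gamma would be 1 modulo p^2, and none could
    approximate 1 + p modulo p^2. *)
Lemma topological_generator_unit (gamma : Z_p) : topological_generator gamma ->
  exists2 y : Z_p, y \is a GRing.unit & gamma = 1 + p%:R * y.
Proof.
move=> [[y yE] dense]; have gE : gamma = 1 + p%:R * y by rewrite -yE; ring.
exists y => //; rewrite unit_pideal1; apply/negP => y1.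
have g2 : gamma - 1 \in pideal 2 by rewrite yE -[p%:R]expr1 -(addn1 1) pideal_mul ?pideal_exp.
have gU : gamma \is a GRing.unit by apply: unit_near1; apply: pideal_le g2.
have gX (x : Z_p) n : x - 1 \in pideal 2 -> x ^+ n - 1 \in pideal 2.
  by move=> x2; rewrite subrX1 pideal_mulr.
have gn (n : int) : exists2 x : Z_p, x - 1 \in pideal 2 & tofrac gamma ^ n = tofrac x.
  case: n => n; first by exists (gamma ^+ n); rewrite ?gX ?tofracXn.
  exists ((gamma^-1) ^+ n.+1).
    apply: gX; have -> : gamma^-1 - 1 = - gamma^-1 * (gamma - 1).
      by rewrite mulNr mulrBr mulVr // mulr1 opprB.
    exact: pideal_mull.
  by rewrite NegzE -exprnN tofracXn rmorphV // exprVn.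
have [|n] := dense (1 + p%:R) _ 2%N; first by exists 1; ring.
have [x x2 ->] := gn n; rewrite -tofracB => /ordp_ge_nat[v v2 /eqP].
rewrite tofrac_eq => /eqP vE.
have : (p%:R ^+ 1 * 1 : Z_p) \in pideal (1 + 1).
  have -> : p%:R ^+ 1 * 1 = (x - 1) - v :> Z_p by rewrite -vE; ring.
  exact: rpredB.
move/pideal_cancel; apply/negP; rewrite -unit_pideal1; exact: unitr1.
Qed.

(** Both logarithms carry a factor p, which cancels; the denominator left is the unit M(y), so the
    quotient stays in Z_p<z>. *)
Lemma log_base_tate (gamma s t : Z_p) : odd p -> topological_generator gamma ->
  exists l L, tate_rep l L /\ forall z,
    log_base (tofrac gamma) (tofrac (1 + p%:R * (s + t * z))) = tofrac (L z) :> Q_p.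
Proof.
move=> p_odd /topological_generator_unit[y yU ->]; have [mu [mu0 mup muE]] := log_coef p_pr p_odd.
have mu_small k n : (k.*2 <= n)%N -> mu n \in pideal k.
  by move=> kn; apply: pideal_le (mup n); lia.
have /choice[M Mcvg] : forall x : Z_p, exists l, zcvg (fun n => \sum_(i < n) mu i * x ^+ i.+1) l.
  move=> x; apply: (zseries_cvg (u := fun i => mu i * x ^+ i.+1)) => k.
  by exists k.*2 => n /mu_small kn; rewrite subr0 pideal_mulr.
have MU : M y \is a GRing.unit.
  (* All terms after the first lie in p Z_p, hence M(y) = y modulo p. *)
  have h : M y - \sum_(i < 1) mu i * y ^+ i.+1 \in pideal 1.
    apply: (zseries_tail (u := fun i => mu i * y ^+ i.+1) (Mcvg y)) => i i1; rewrite pideal_mulr //.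
    by apply: pideal_le (mup i); lia.
  move: h; rewrite big_ord1 mu0 mul1r => h.
  rewrite unit_pideal1; apply: contraTN yU => My.
  by rewrite unit_pideal1 negbK -[y](subKr (M y)) rpredB.
have [f fP] : exists f, tate_rep f (fun z => M (s + t * z)).
  (* Expanded in z, the n-th term is a polynomial all of whose coefficients are divisible by
     [mu n]. *)
  apply: (@tate_rep_series _ _ (fun n => mu n *: (s%:P + t *: 'X) ^+ n.+1)).
    by move=> k; exists k.*2 => n i /mu_small kn; rewrite coefZ pideal_mulr.
  move=> z; congr (zcvg _ _): (Mcvg (s + t * z)); apply/funext => n.
  by apply: eq_bigr => i _; rewrite !hornerE.
do 2!eexists; split; first exact: tate_repM fP (tate_rep_cst (M y)^-1).
move=> z; rewrite /log_base (logp_series muE (Mcvg y)) (logp_series muE (Mcvg _)).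
rewrite !tofracM rmorphV // rmorph_nat invfM mulrACA divff ?mul1r //.
by rewrite -(rmorph_nat (@tofrac Z_p)) tofrac_eq0 -[_%:R]expr1 expp_neq0.
Qed.

Lemma teichmuller_factor (a c : Z_p) : a \is a GRing.unit -> in_pZp c ->
  exists s t : Z_p, forall z : Z_p,
    tofrac (a + c * z) / tofrac (teichmuller a) =
    tofrac (1 + p%:R * (s + t * z)) :> Q_p.
Proof.
move=> aU [c' ->]; have [_ wa] := teichmullerP aU; set w := teichmuller a in wa *.
have wU : w \is a GRing.unit.
  rewrite unit_pideal1; apply: contraTN aU => w1.
  by rewrite unit_pideal1 negbK -[a](subKr w) rpredB.
have /in_pZpE[b bE] := wa.
(* With w - a = p b and c = p c', the quotient is 1 + p (- b + c' z) / w. *)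
exists (- b / w), (c' / w) => z; rewrite -rmorphV // -tofracM; congr tofrac.
have -> : a = w - p%:R * b by rewrite -bE; ring.
have := divrr wU; move: (w^-1) => v wv.
by transitivity (w * v + p%:R * (- b * v + c' * v * z)); [ring | rewrite wv].
Qed.

(** [G n] is L (L - 1) ... (L - n + 1), with L the logarithm to base gamma. The denominator n! of
    the binomial coefficient goes into [e n] = p^n / n!, which keeps every term in Z_p. *)
Lemma kernel_coef (gamma a c : Z_p) : odd p -> topological_generator gamma ->
  a \is a GRing.unit -> in_pZp c ->
  exists (g : nat -> nat -> Z_p) (G : nat -> Z_p -> Z_p),
    (forall n, tate_rep (g n) (G n)) /\
    forall (e : nat -> Z_p), (forall n, e n * n`!%:R = p%:R ^+ n) ->
    forall m z x, kernelK gamma a c m z x = tofrac (teichmuller a ^+ m) *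
      psum (fun n => tofrac (e n * G n z * x ^+ n)).
Proof.
move=> p_odd gg aU cp; have [s [t stE]] := teichmuller_factor aU cp.
have [l [L [lL LE]]] := log_base_tate s t p_odd gg.
have /choice[g gG] n := @tate_rep_prod _ _ _ _
  (fun k : nat => tate_repB lL (tate_rep_cst k%:R)) n.
exists g, (fun n z => \prod_(k < n) (L z - k%:R)); split=> // e eE m z x.
rewrite /kernelK tofracXn; congr (_ * psum _); apply/funext => n.
have n0 : n`!%:R != 0 :> Q_p.
  by rewrite -(rmorph_nat (@tofrac Z_p)) tofrac_eq0 pnatr_eq0 -lt0n fact_gt0.
rewrite stE LE /binomp; apply: (mulIf n0); rewrite mulrAC divfK //.
rewrite -(rmorph_nat (@tofrac Z_p) p) -(rmorph_nat (@tofrac Z_p) n`!).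
have -> : \prod_(k < n) (tofrac (L z) - k%:R) = tofrac (\prod_(k < n) (L z - k%:R)) :> Q_p.
  by rewrite rmorph_prod; apply: eq_bigr => k _; rewrite /= tofracB rmorph_nat.
rewrite -tofracM -tofracXn -!tofracM; congr tofrac; rewrite exprMn -eE; ring.
Qed.
End Kernel.

(** Legendre's bound gives n - ord_p(n!) >= n - n / (p - 1), which is n c_p. *)
Lemma ordp_ge_c_p (p : nat) (p_pr : prime p) n (x : padic_int p_pr) :
  x \in pideal (n - logn p n`!) -> ((n%:R * c_p p)%:E <= ordp (tofrac x))%E.
Proof.
move=> xn; have le : (((n - logn p n`!)%N%:R : rat)%:E <= ordp (tofrac x))%E.
  by apply/ordp_ge_nat; exists x.
apply: le_trans le; rewrite lee_fin /c_p.
have p1 : (1 < p)%N := prime_gt1 p_pr; have ub := logn_fact_ub n p_pr.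
rewrite natrB; last by apply: leq_trans ub; rewrite leq_pmull //; lia.
have -> : p%:R - 1 = p.-1%:R :> rat by rewrite -subn1 natrB // ltnW.
rewrite mulrBr mulr1 lerB // mulrA mulr1 ler_pdivlMr ?ltr0n; last by lia.
by rewrite mulrC -natrM ler_nat.
Qed.

(** * The double expansion and its place in the completed tensor product *)

Section Expansion.
Variables (p : nat) (p_pr : prime p).
Local Notation Z_p := (padic_int p_pr).
Local Notation Q_p := (padic p_pr).
Variables (g : nat -> nat -> Z_p) (G : nat -> Z_p -> Z_p) (e : nat -> Z_p).
Variables (c : Z_p).
Hypothesis gG : forall n, tate_rep (g n) (G n).
Hypothesis e0 : zcvg e 0.

(** The coefficient of z^i w^j in the kernel, once [c] is taken to be omega(a)^m and [e j] to be p^j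
    / j!. *)
Definition coef2 (i j : nat) : Q_p := tofrac (c * (g j i * e j)).

(** For j >= J the factor [e j] is small; for each of the finitely many j < J, the sequence [g j]
    tends to 0. *)
Lemma coef2_tate2 : tate2 coef2.
Proof.
move=> k; have [J eJ] := e0 k.
have /choice[N gN] j : exists N, forall n, (N <= n)%N -> g j n \in pideal k.
  by have [N gN] := tate_rep_cvg k (gG j); exists N => n /gN[].
exists (J + \max_(j < J) N j)%N => i j ij; apply/ordp_ge_nat; eexists=> //.
apply: pideal_mull; have [Jj|jJ] := leqP J j.
  by rewrite pideal_mull // -[e j]subr0 eJ.
rewrite pideal_mulr // gN //; move: ij.
have : (N j <= \max_(j < J) N j)%N by exact: (@leq_bigmax 'I_J (fun t => N t) (Ordinal jJ)).
move: (\max_(j < J) N j)%N => M; lia.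
Qed.

Lemma coef2_expands (F : Z_p -> Z_p -> Q_p) :
  (forall z x, F z x = tofrac c * psum (fun n => tofrac (e n * G n z * x ^+ n))) ->
  expands F coef2.
Proof.
move=> FE; split=> [|z x k]; first exact: coef2_tate2.
have [|S SE] := zseries_cvg (u := fun n => e n * G n z * x ^+ n).
  move=> h; have [J eJ] := e0 h; exists J => n /eJ; rewrite !subr0 => en.
  by rewrite -mulrA pideal_mulr.
rewrite FE (psum_tofrac SE); have [N SN] := SE k; have [J eJ] := e0 k.
have /choice[H HP] j : exists N, forall n, (N <= n)%N ->
    \sum_(i < n) g j i * z ^+ i - G j z \in pideal k.
  by have [M gM] := tate_rep_cvg k (gG j); exists M => n /gM[].
exists (N + J + \max_(j < J) H j)%N => n nN; apply/ordp_ge_nat.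
exists (c * (\sum_(j < n) e j * (\sum_(i < n) g j i * z ^+ i) * x ^+ j - S)).
  (* Two errors are bounded: truncating each [G j] in z, which matters only for j < J, and
     truncating the sum over j. *)
  rewrite pideal_mull // -(subrKA (\sum_(j < n) e j * G j z * x ^+ j)) rpredD //.
    rewrite -sumrB rpred_sum // => j _; rewrite -mulrBl -mulrBr pideal_mulr //.
    have [Jj|jJ] := leqP J j; first by rewrite pideal_mulr // -[e j]subr0 eJ.
    rewrite pideal_mull // HP //.
    have : (H j <= \max_(j < J) H j)%N by exact: (@leq_bigmax 'I_J (fun t => H t) (Ordinal jJ)).
    by move: (\max_(j < J) H j)%N nN => M; lia.
  by apply: SN; lia.
rewrite mulrBr tofracB (tofracM c S) mulr_sumr rmorph_sum exchange_big; congr (_ - _).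
apply: eq_bigr => j _; rewrite mulr_sumr mulr_suml mulr_sumr rmorph_sum.
apply: eq_bigr => i _; rewrite /coef2 -!tofracXn -!tofracM; congr tofrac; ring.
Qed.

(** Modulo p^k only the columns j < J survive, and column t is the product of c G_t(z) in Z_p<z>
    with the monomial e_t w^t in S_w. *)
Lemma coef2_tensor : (forall n : nat, ((n%:R * c_p p)%:E <= ordp (tofrac (e n)))%E) ->
  tate_Zp_tensor_S coef2.
Proof.
move=> eS; split=> [|k]; first exact: coef2_tate2.
have ordp0 x : (x <= ordp (0%R : Q_p))%E by rewrite /ordp eqxx leey.
have [J eJ] := e0 k.
exists J, (fun (t : 'I_J) i => tofrac (c * g t i)),
  (fun (t : 'I_J) (j : nat) => if j == t then tofrac (e t) else 0).
split=> [t|t|i j].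
- split=> [|n]; last by eexists.
  apply: (cvgp_tofrac (l := 0)) => h; have [N gN] := tate_rep_cvg h (gG t).
  by exists N => n /gN[gn _]; rewrite subr0 pideal_mull.
- split=> [h|n]; last by case: eqP => [->|].
  by exists t.+1 => n tn; rewrite gtn_eqF // subr0.
have [Jj|jJ] := leqP J j.
  rewrite big1 ?subr0 => [|t _]; last by rewrite gtn_eqF ?mulr0 // (leq_trans _ Jj).
  apply/ordp_ge_nat; eexists=> //; do 2!apply: pideal_mull.
  by rewrite -[e j]subr0 eJ.
rewrite (bigD1 (Ordinal jJ)) //= eqxx big1 ?addr0 => [|t tj]; last first.
  by rewrite ifN ?mulr0 // eq_sym.
by rewrite -tofracM -mulrA subrr.
Qed.
End Expansion.

Theorem theorem2p16 (p : nat) (p_pr : prime p) (p_odd : odd p)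
    (gamma : padic_int p_pr) (gamma_gen : topological_generator gamma)
    (m : nat) (m_le : (m <= p - 2)%N)
    (a : padic_int p_pr) (a_unit : a \is a GRing.unit)
    (c : padic_int p_pr) (c_pZp : in_pZp c) :
  (exists alpha : nat -> nat -> padic p_pr,
     expands (kernelK gamma a c m) alpha /\ tate_Zp_tensor_S alpha) /\
  (forall alpha : nat -> nat -> padic p_pr,
     expands (kernelK gamma a c m) alpha ->
     forall i j : nat,
       in_Zp (alpha i j) /\ ((j%:R * c_p p)%:E <= ordp (alpha i j))%E).
Proof.
have [e eP] := fact_coef p_pr p_odd.
have e0 : zcvg e 0.
  (* As p - 1 >= 2, Legendre's bound gives ord_p(n!) <= n / 2, so n - ord_p(n!) >= k once n >= 2
     k. *)
  move=> k; exists k.*2 => n kn; rewrite subr0; apply: pideal_le (proj2 (eP n)).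
  have := logn_fact_ub n p_pr; have := odd_prime_gt2 p_odd p_pr; nia.
have [g [G [gG KE]]] := kernel_coef p_odd gamma_gen a_unit c_pZp.
have aK : expands (kernelK gamma a c m) (coef2 g e (teichmuller a ^+ m)).
  by apply: (coef2_expands gG e0) => z x; apply: KE => n; case: (eP n).
(* By uniqueness any expansion has the explicit coefficients, for which integrality and the bound
   are visible. *)
split=> [|alpha /expands_unique/(_ aK) aE i j].
  exists (coef2 g e (teichmuller a ^+ m)); split=> //; apply: coef2_tensor => // n.
  by apply: ordp_ge_c_p; case: (eP n).
rewrite aE; split; first by eexists.
by apply: ordp_ge_c_p; do 2!apply: pideal_mull; case: (eP j).
Qed.
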